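(* Let $T$ be a topological space, let $C(T)$ be the Banach space of bounded continuous real-valued functions on $T$ with the norm $\|x\|=\sup_{t\in T}|x(t)|$, and let $Y$ be a real linear topological space. Then every bounded-differentiable germ at $0\in C(T)$ into $Y$ has a global bounded-differentiable representative, and every compact-differentiable germ at $0\in C(T)$ into $Y$ has a global compact-differentiable representative.
   Context: Differentiability. A map $f$ from a neighborhood of $x$ in a linear topological space $X$ to a linear topological space $Y$ is differentiable at $x$ if there is a continuous linear $A:X\to Y$ such that, with $r(h)=f(x+h)-f(x)-Ah$: (i) bounded differentiability: for every bounded set $S\subset X$, $r(th)/t\to 0$ as $t\to 0$ ($t\in\mathbb{R}$), uniformly in $h\in S$; (ii) compact (Hadamard) differentiability: $f(x+t_nh_n)-f(x)=t_nAh+o(t_n)$ whenever $t_n\to 0$ in $\mathbb{R}$ and $h_n\to h$ in $X$. A map is differentiable on a set if it is differentiable at every point of it. Germs. A germ at $0\in X$ into $Y$ is an equivalence class of maps into $Y$ defined on neighborhoods of $0$, any two of which coincide on some neighborhood of $0$; its elements are called representatives. A germ is differentiable (in a given sense) if it has a representative differentiable in that sense on a neighborhood of $0$. A global differentiable representative is a representative defined and differentiable (in that sense) on all of $X$. *)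

(* Defs.v *)
From HB Require Import structures.
From mathcomp Require Import all_boot all_order all_algebra.
From mathcomp Require Import all_classical all_reals.
From mathcomp Require Import interval_inference topology normedtype ring.

Set Implicit Arguments.
Unset Strict Implicit.
Unset Printing Implicit Defensive.

Import Order.TTheory GRing.Theory Num.Theory.
Import numFieldNormedType.Exports.

Local Open Scope classical_set_scope.
Local Open Scope ring_scope.

Section BoundedContinuous.
Context (T : topologicalType) (R : realType).

Definition bounded_continuous : {pred T -> R} :=
  mem [set f : T -> R | continuous f /\ bounded_fun f].

Record bcfun := BCFun {
  bcfun_fun :> T -> R;
  bcfun_subproof : bcfun_fun \in bounded_continuous
}.

HB.instance Definition _ := [isSub for bcfun_fun].
HB.instance Definition _ := [Choice of bcfun by <:].

Lemma bcfun_continuous (x : bcfun) : continuous x.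
Proof. by have := bcfun_subproof x; rewrite inE => -[]. Qed.

Lemma bcfun_bounded (x : bcfun) : bounded_fun x.
Proof. by have := bcfun_subproof x; rewrite inE => -[]. Qed.

Lemma bounded_continuous_submod_closed : submod_closed bounded_continuous.
Proof.
split=> [|a f g]; rewrite !inE.
  split; first by move=> t; exact: cvg_cst.
  exact: (bounded_cst (0 : R)).
move=> [fc fb] [gc gb]; split.
  by move=> t; apply: cvgD; [apply: cvgZl_tmp; exact: fc|exact: gc].
apply: (@bounded_funD T R (a *: f)) => //.
have [M [Mreal Mf]] := fb.
exists (`|a| * (`|M| + 1)); split; first exact: num_real.
move=> N aMN t _ /=; rewrite normrM (le_trans _ (ltW aMN))//.
by rewrite ler_wpM2l// Mf// (le_lt_trans (ler_norm _))// ltrDl.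
Qed.

HB.instance Definition _ := GRing.isSubmodClosed.Build R (T -> R)
  bounded_continuous bounded_continuous_submod_closed.
HB.instance Definition _ := [SubChoice_isSubLmodule of bcfun by <:].

(* [sup set0 = 0], so the norm is also right when [T] is empty. *)
Definition supnorm (x : bcfun) : R := sup (range (fun t => `|x t|)).

Lemma supnorm_ub (x : bcfun) (t : T) : `|x t| <= supnorm x.
Proof.
apply: sup_upper_bound; last by exists t.
split; first by exists `|x t|, t.
have [M [_ Mx]] := bcfun_bounded x.
by exists (M + 1) => _ [s _ <-]; apply: Mx => //; rewrite ltrDl.
Qed.

Lemma supnorm_empty (x : bcfun) : ~ ([set: T] !=set0) -> supnorm x = 0.
Proof.
move=> T0; rewrite /supnorm; set E := (X in sup X).
rewrite (_ : E = set0) ?sup0//.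
by apply/seteqP; split=> [r [t _ _]|//]; case: T0; exists t.
Qed.

Lemma supnorm_le (x : bcfun) (M : R) :
  0 <= M -> (forall t, `|x t| <= M) -> supnorm x <= M.
Proof.
move=> M0 xM; have [[t _]|T0] := pselect ([set: T] !=set0).
  by apply: ge_sup; [exists `|x t|, t | move=> _ [s _ <-]].
by rewrite supnorm_empty.
Qed.

Lemma supnorm_ge0 (x : bcfun) : 0 <= supnorm x.
Proof.
have [[t _]|T0] := pselect ([set: T] !=set0).
  exact: le_trans (supnorm_ub x t).
by rewrite supnorm_empty.
Qed.

Lemma supnormD (x y : bcfun) : supnorm (x + y) <= supnorm x + supnorm y.
Proof.
apply: supnorm_le => [|t]; first by rewrite addr_ge0 ?supnorm_ge0.
by rewrite (le_trans (ler_normD _ _))// lerD ?supnorm_ub.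
Qed.

Lemma supnormZ (a : R) (x : bcfun) : supnorm (a *: x) = `|a| * supnorm x.
Proof.
have leZ b y : supnorm (b *: y) <= `|b| * supnorm y.
  apply: supnorm_le => [|t]; first by rewrite mulr_ge0 ?supnorm_ge0.
  by rewrite /= normrM ler_wpM2l ?supnorm_ub.
apply/eqP; rewrite eq_le leZ/=.
have [->|a0] := eqVneq a 0; first by rewrite normr0 mul0r supnorm_ge0.
have := leZ a^-1 (a *: x); rewrite scalerA mulVf// scale1r.
by rewrite normfV mulrC ler_pdivlMr ?normr_gt0// mulrC.
Qed.

Lemma supnorm0_eq0 (x : bcfun) : supnorm x = 0 -> x = 0.
Proof.
move=> x0; apply/val_inj/funext => t /=.
by apply/eqP; rewrite -normr_le0 -x0 supnorm_ub.
Qed.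

HB.instance Definition _ :=
  Lmodule_isNormed.Build R bcfun supnormD supnormZ supnorm0_eq0.

Lemma bcfun_cauchy_cvg (F : set_system bcfun) :
  ProperFilter F -> cauchy F -> cvg F.
Proof.
move=> FF /cauchy_ballP Fc.
have Fb (e : R) : 0 < e -> \forall x & y \near F, `|x - y| < e.
  by move=> e0; have := Fc e e0; rewrite -ball_normE.
have Fe (e : R) : 0 < e -> exists2 A, F A &
    forall x y, A x -> A y -> forall t, `|x t - y t| < e.
  move=> e0; have [[A B]/= [FA FB] AB] := Fb e e0.
  exists (A `&` B); first exact: filterI.
  move=> x y [Ax _] [_ By] t; have := AB (x, y) (conj Ax By) => /=.
  exact/le_lt_trans/(supnorm_ub (x - y) t).
have Ft t : cvg ((fun x : bcfun => x t) @ F).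
  apply: cauchy_cvg; apply/cauchy_ballP => e e0.
  have [A FA Ae] := Fe e e0.
  pose P := (fun x : bcfun => x t) @` A.
  have FP : F ((fun x : bcfun => x t) @^-1` P).
    by apply: filterS FA => x Ax; exists x.
  exists (P, P) => // -[_ _] [/= [x Ax <-] [y Ay <-]].
  by rewrite -ball_normE /=; exact: Ae.
pose l t := lim ((fun x : bcfun => x t) @ F).
have Fl (e : R) : 0 < e -> \forall x \near F, forall t, `|l t - (x : bcfun) t| <= e.
  move=> e0; have [A FA Ae] := Fe e e0.
  apply: (filterS _ FA) => x Ax t; apply/ler_addgt0Pr => d d0.
  have /cvgrPdist_le/(_ _ d0) ld := Ft t.
  have [y [Ay lyd]] := filter_ex (filterI FA ld).
  rewrite (le_trans (ler_distD (y t) _ _))// addrC lerD//.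
  exact/ltW/Ae.
have lP : l \in bounded_continuous.
  rewrite inE; split.
    move=> t; apply/cvgrPdist_le => e e0.
    have e3 : 0 < e / 3 by rewrite divr_gt0.
    have [x xl] := filter_ex (Fl _ e3).
    have /cvgrPdist_le/(_ _ e3) := @bcfun_continuous x t.
    apply: filterS => s xts.
    rewrite (le_trans (ler_distD (x t) _ _))//.
    have -> : e = e / 3 + (e / 3 + e / 3) by field.
    rewrite lerD// (le_trans (ler_distD (x s) _ _))// lerD//.
    by rewrite distrC.
  have [x xl] := filter_ex (Fl _ ltr01).
  exists (supnorm x + 1); split; first exact: num_real.
  move=> M xM t _ /=; rewrite (le_trans _ (ltW xM))//.
  rewrite -(subrK (x t) (l t)) addrC (le_trans (ler_normD _ _))//.
  by rewrite lerD ?supnorm_ub.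
apply: (@cvgP _ _ (BCFun lP)); apply/cvgrPdist_le => e e0.
apply: filterS (Fl e e0) => x xl.
by apply: supnorm_le => //; exact: ltW.
Qed.

HB.instance Definition _ := Uniform_isComplete.Build bcfun bcfun_cauchy_cvg.

End BoundedContinuous.
Arguments bcfun : clear implicits.

Section Differentiability.
Context {R : realType} {X Y : topologicalLmodType R}.

(* Von Neumann boundedness. *)
Definition tvs_bounded (S : set X) : Prop :=
  forall V : set X, nbhs 0 V -> \forall r \near +oo, S `<=` ( *:%R r) @` V.

(* Here and below a map defined on a set [D] is a total function whose values
   outside of [D] are irrelevant. *)
Definition bounded_differentiable_at (D : set X) (f : X -> Y) (x : X) : Prop :=
  nbhs x D /\
  exists A : {linear X -> Y}, continuous A /\
    let r h := f (x + h) - f x - A h in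
    forall S, tvs_bounded S -> forall V : set Y, nbhs 0 V ->
      \forall t \near (0 : R)^', forall h, S h -> V (t^-1 *: r (t *: h)).

(* [o(t_n)] is rendered as [t_n *: e_n] with [e_n --> 0]; for finitely many [n]
   the point [x + t_n *: h_n] may lie outside of [D]. *)
Definition compact_differentiable_at (D : set X) (f : X -> Y) (x : X) : Prop :=
  nbhs x D /\
  exists A : {linear X -> Y}, continuous A /\
    forall (t_ : nat -> R) (h_ : nat -> X) (h : X),
      t_ @ \oo --> 0 -> h_ @ \oo --> h ->
      exists2 e : nat -> Y, e @ \oo --> 0 &
        \forall n \near \oo,
          f (x + t_ n *: h_ n) - f x = t_ n *: A h + t_ n *: e n.

End Differentiability.

Section Germs.
Context {R : realType} {X Y : topologicalLmodType R}.

Record local_map := LocalMap {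
  dom : set X;
  dom_nbhs : nbhs 0 dom;
  map_of :> X -> Y
}.

Definition same_germ (f g : local_map) : Prop :=
  exists2 V, nbhs (0 : X) V &
    V `<=` dom f `&` dom g /\ forall x, V x -> f x = g x.

Lemma same_germ_refl f : same_germ f f.
Proof. by exists (dom f); [exact: dom_nbhs|rewrite setIid; split]. Qed.

Lemma same_germ_sym f g : same_germ f g -> same_germ g f.
Proof.
move=> [V V0 [VD fg]]; exists V => //; split; first by rewrite setIC.
by move=> x /fg.
Qed.

Lemma same_germ_trans f g h : same_germ f g -> same_germ g h -> same_germ f h.
Proof.
move=> [V V0 [VD fg]] [W W0 [WD gh]].
exists (V `&` W); first exact: filterI.
split=> [x [/VD[? _] /WD[_ ?]]//|x [Vx Wx]].
by rewrite fg// gh.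
Qed.

Record germ := Germ {
  representative :> set local_map;
  germ_class : exists f, representative = [set g | same_germ f g]
}.

(* The argument [diff] stands for either sense of differentiability of a map
   defined on a set, at a point. *)
Implicit Types (diff : set X -> (X -> Y) -> X -> Prop) (G : germ).

Definition differentiable_on diff (f : local_map) (W : set X) : Prop :=
  forall x, W x -> diff (dom f) f x.

Definition differentiable_germ diff G : Prop :=
  exists2 f, representative G f &
    exists2 W, nbhs (0 : X) W & differentiable_on diff f W.

Definition global_representative diff G (f : local_map) : Prop :=
  [/\ representative G f, dom f = setT & differentiable_on diff f setT].

End Germs.
Arguments local_map {R} X Y.
Arguments germ {R} X Y.

(* Main.v *)
Require Import Defs.
From HB Require Import structures.
From mathcomp Require Import all_boot all_order all_algebra.
From mathcomp Require Import all_classical all_reals topology normedtype.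
From mathcomp Require Import landau derive ring lra.

Set Implicit Arguments.
Unset Strict Implicit.
Unset Printing Implicit Defensive.

Import Order.TTheory GRing.Theory Num.Theory.
Import numFieldNormedType.Exports.

Local Open Scope classical_set_scope.
Local Open Scope ring_scope.

(** A germ extends globally as soon as the space retracts smoothly into every
    neighborhood of [0]: if [f] represents the germ and is differentiable on a
    neighborhood [W] of [0], and if [p] is an everywhere Frechet differentiable
    map of the space into [W] that is the identity near [0], then [f \o p] is
    defined everywhere, coincides with [f] near [0], and is differentiable
    everywhere by the chain rule ([global_representative_exists]).

    In [C(T)] the retraction is a superposition operator [x |-> g \o x]
    ([bcfun_local_retraction]): take for [g] a real function that is the
    identity near [0], has small values everywhere, and satisfies
    [|g (s + h) - g s - g' s * h| <= K * h ^ 2] uniformly in [s].  As this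
    estimate holds at every point of [T] with the same constant, it passes to
    sup norms and shows that the operator is Frechet differentiable, its
    derivative at [x] being the multiplication by [g' \o x]
    ([differentiable_superposition]).  A suitable [g] is piecewise quadratic
    ([soft_trunc_scaled]).

    The chain rule is proved for a Frechet differentiable inner map between
    normed spaces and an outer map differentiable in either of the two senses,
    with values in a linear topological space.  Both cases rest on the same
    observation: the increment of [p] is [t *: k], where [k] differs from
    ['d p x h] by an error that tends to [0] with [t], uniformly for bounded
    [h].  So bounded families of directions are sent to bounded families
    ([bounded_differentiable_comp]), and convergent sequences of directions to
    convergent ones ([compact_differentiable_comp]). *)

(** * Frechet remainders *)

Section FrechetRemainder.
Context {R : realType} {X Z : normedModType R}.

(** ['d f x] is by definition a choice of continuous linear map with remainder
    [o(h)]; the uniqueness of such a map identifies it with [B]. *)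
Lemma differentiable_quadratic (f : X -> Z) (x : X) (B : {linear X -> Z})
    (K : R) :
  continuous B ->
  (forall h, `|f (x + h) - f x - B h| <= K * `|h| ^+ 2) ->
  differentiable f x.
Proof.
move=> Bc fB.
have fxB : f \o shift x = cst (f x) + B +o_ 0 id.
  apply/eqaddoP => e e0.
  have d0 : 0 < e / (`|K| + 1) by rewrite divr_gt0// ltr_wpDl.
  near=> h.
  have -> : (f \o shift x - (cst (f x) + B)) h = f (x + h) - f x - B h.
    by rewrite !fctE /= opprD addrA (addrC h).
  rewrite (le_trans (fB h))// expr2 mulrA ler_wpM2r//.
  have : `|h| <= e / (`|K| + 1) by near: h; exact: nbhs0_le.
  rewrite ler_pdivlMr ?ltr_wpDl// => /(le_trans _); apply.
  by rewrite mulrC ler_wpM2l// (le_trans (ler_norm K))// lerDl.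
by apply/diff_locallyP; rewrite (diff_unique Bc fxB).
Unshelve. all: by end_near. Qed.

(** Frechet differentiability in the form that both chain rules use, with the
    increment written [t *: h] and the remainder divided by [t]. *)
Lemma differentiable_quotient (f : X -> Z) (x : X) (M e : R) :
  differentiable f x -> 0 < e ->
  \forall t \near (0 : R), forall h, `|h| <= M ->
    `|t^-1 *: (f (x + t *: h) - f x - 'd f x (t *: h))| <= e.
Proof.
move=> fx e0.
pose N := `|M| + 1.
have N0 : 0 < N by rewrite ltr_wpDl.
have eN0 : 0 < e / N by rewrite divr_gt0.
have /diff_locallyP[_ /eqaddoP/(_ _ eN0)] := fx.
rewrite -nbhs_nearE => /nbhs_norm0P[d /= d0 fd].
have dN0 : 0 < d / N by rewrite divr_gt0.
apply: filterS (@pseudometric_normed_Zmodule.nbhs0_lt R R^o _ dN0).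
move=> t td h hM.
have hN : `|h| <= N.
  by rewrite (le_trans hM)// (le_trans (ler_norm M))// lerDl.
have [->|t0] := eqVneq t 0; first by rewrite invr0 scale0r normr0 ltW.
have /fd : `|t *: h| < d.
  by rewrite normrZ (le_lt_trans (ler_wpM2l _ hN))// -ltr_pdivlMr.
rewrite !fctE /= opprD addrA (addrC _ x) => fth.
rewrite normrZ normfV ler_pdivrMl ?normr_gt0// (le_trans fth)//.
rewrite normrZ mulrCA ler_wpM2l// mulrAC -mulrA ler_piMr ?(ltW e0)//.
by rewrite ler_pdivrMr// mul1r.
Qed.

End FrechetRemainder.

(** * Chain rules with a Frechet differentiable inner map *)

Section ChainRules.
Context {R : realType} {X Z : normedModType R} {Y : topologicalLmodType R}.

Lemma tvs_bounded_norm (S : set X) :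
  tvs_bounded S -> exists M : R, forall h, S h -> `|h| <= M.
Proof.
move=> /(_ (fun x => `|x| < 1)) Sb.
have /Sb/pinfty_ex_gt0[r r0 Sr] : nbhs (0 : X) (fun x => `|x| < 1).
  exact: pseudometric_normed_Zmodule.nbhs0_lt.
exists r => h /Sr[y /= y1 <-].
by rewrite normrZ gtr0_norm// ler_piMr ?ltW.
Qed.

Lemma tvs_bounded_closed_ball (M : R) : tvs_bounded [set z : Z | `|z| <= M].
Proof.
move=> V /nbhs_norm0P[e /= e0 eV].
near=> r => z /= zM.
have r0 : 0 < r by near: r; exact: nbhs_pinfty_gt.
exists (r^-1 *: z); last by rewrite scalerA divff ?scale1r ?gt_eqF.
apply: eV => /=.
rewrite normrZ normfV gtr0_norm// ltr_pdivrMl//.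
rewrite (le_lt_trans zM)// -ltr_pdivrMr//.
by near: r; apply: nbhs_pinfty_gt; exact: num_real.
Unshelve. all: by end_near. Qed.

Lemma nbhs0_split (V : set Y) : nbhs 0 V ->
  exists2 W, nbhs 0 W & forall y z, W y -> W z -> V (y + z).
Proof.
have := @add_continuous Y (0, 0); rewrite /continuous_at /= addr0 => cY.
move=> /cY [[W1 W2] /= [W10 W20] WV].
exists (W1 `&` W2); first exact: filterI.
by move=> y z [y1 _] [_ z2]; exact: (WV (y, z)).
Qed.

(** No condition [t != 0]: when [t = 0] both sides are [p x]. This matters for
    compact differentiability, whose sequences [t_n] may vanish. *)
Lemma increment_quotient (p : X -> Z) (B : {linear X -> Z}) (x h : X) (t : R) :
  p (x + t *: h) =
  p x + t *: (B h + t^-1 *: (p (x + t *: h) - p x - B (t *: h))).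
Proof.
have [->|t0] := eqVneq t 0; first by rewrite !scale0r !addr0.
rewrite scalerDr scalerA divff// scale1r linearZ/=.
by rewrite (addrC (t *: B h)) subrK subrKC.
Qed.

(** With [p (x + t *: h) = p x + t *: k], the remainder of [f \o p] is that of
    [f] in the direction [k] plus [A z], where [z := k - 'd p x h]. The former
    is small because [k] stays in a fixed ball, the latter because [z] is
    small and [A] is continuous. *)
Lemma bounded_differentiable_comp (D : set Z) (f : Z -> Y) (p : X -> Z)
    (x : X) :
  differentiable p x -> bounded_differentiable_at D f (p x) ->
  bounded_differentiable_at (p @^-1` D) (f \o p) x.
Proof.
move=> px [Dpx [A [Ac fA]]]; split.
  exact: (differentiable_continuous px).
have /diff_locallyP[Bc _] := px.
exists (A \o 'd p x); split.
  by move=> y; exact: (continuous_comp (Bc y) (Ac _)).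
move=> r S /tvs_bounded_norm[M SM] V /nbhs0_split[W W0 WV].
have /linear_bounded_continuous/linear_boundedP/pinfty_ex_gt0[L L0 BL] := Bc.
have /nbhs_norm0P[d /= d0 dW] : nbhs (0 : Z) (A @^-1` W).
  by apply: Ac; rewrite linear0.
(* [e <= 1] keeps [k] in the ball of radius [L * M + 1], and [e < d] puts
   [A z] in [W]. *)
pose e := Num.min 1 (d / 2).
have e0 : 0 < e by rewrite lt_min ltr01 divr_gt0.
have fAt := fA _ (tvs_bounded_closed_ball (L * M + 1)) _ W0.
have pt := @differentiable_quotient _ _ _ p x M e px e0.
near=> t => h Sh; rewrite /r /=.
have t0 : t != 0 by near: t; exact: nbhs_dnbhs_neq.
have hM := SM h Sh.
have zL : `|t^-1 *: (p (x + t *: h) - p x - 'd p x (t *: h))| <= e.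
  by move: h hM {Sh}; near: t; exact: nbhs_dnbhs.
have := increment_quotient p ('d p x) x h t.
set z := t^-1 *: _ in zL *; set k := 'd p x h + z => pk.
have kL : `|k| <= L * M + 1.
  rewrite (le_trans (ler_normD _ _))// lerD//.
    by rewrite (le_trans (BL h))// ler_wpM2l// ltW.
  by rewrite (le_trans zL)// ge_min lexx.
have -> : t^-1 *: (f (p (x + t *: h)) - f (p x) - A ('d p x (t *: h))) =
    t^-1 *: (f (p x + t *: k) - f (p x) - A (t *: k)) + A z.
  rewrite -pk (linearZ_LR A t k) /= (linearZ_LR ('d p x) t h) /=.
  rewrite (linearZ_LR A t) /= /k (linearD A) /= !scalerBr !scalerA mulVf//.
  by rewrite !scale1r opprD addrA addrNK.
apply: WV; last first.
  apply: dW => /=; rewrite (le_lt_trans zL)// gt_min.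
  by rewrite ltr_pdivrMr// ltr_pMr// ltr1n orbT.
by move: k kL {pk}; near: t.
Unshelve. all: by end_near. Qed.

(** When [h_n --> l], the increments of [p] along [t_n *: h_n] are exactly
    [t_n *: k_n] with [k_n --> 'd p x l], so the expansion of [f] along [k_n] is already the
    expansion of [f \o p] along [h_n]. *)
Lemma compact_differentiable_comp (D : set Z) (f : Z -> Y) (p : X -> Z)
    (x : X) :
  differentiable p x -> compact_differentiable_at D f (p x) ->
  compact_differentiable_at (p @^-1` D) (f \o p) x.
Proof.
move=> px [Dpx [A [Ac fA]]]; split.
  exact: (differentiable_continuous px).
have /diff_locallyP[Bc _] := px.
exists (A \o 'd p x); split.
  by move=> y; exact: (continuous_comp (Bc y) (Ac _)).
move=> t h l t0 hl.
pose z n := (t n)^-1 *: (p (x + t n *: h n) - p x - 'd p x (t n *: h n)).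
have z0 : z @ \oo --> 0.
  apply/cvgr0Pnorm_le => e e0.
  have ht : \forall n \near \oo, `|h n| <= `|l| + 1.
    by apply: (@cvgr_norm_le _ _ _ _ _ h l) => //; rewrite ltrDl.
  have := t0 _ (differentiable_quotient (`|l| + 1) px e0).
  by apply: filterS2 ht => n hn; apply.
have kB : (fun n => 'd p x (h n) + z n) @ \oo --> 'd p x l.
  rewrite -[X in _ --> X]addr0; apply: cvgD => //.
  exact: (continuous_cvg _ (Bc l)).
have [e e0 fe] := fA t _ _ t0 kB.
exists e => //; apply: filterS fe => n.
by rewrite /= /z -increment_quotient.
Qed.

End ChainRules.

(** * Superposition operators on bounded continuous functions *)

Section Superposition.
Context {R : realType} {T : topologicalType}.

Lemma bounded_continuous_le (u : T -> R) (M : R) :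
  continuous u -> (forall t, `|u t| <= M) -> u \in @bounded_continuous T R.
Proof.
move=> uc uM; rewrite inE; split=> //.
exists M; split; first exact: num_real.
by move=> N MN t _ /=; rewrite (le_trans (uM t))// ltW.
Qed.

Lemma bcfun_mul_subproof (u x : bcfun T R) :
  (fun t => u t * x t) \in @bounded_continuous T R.
Proof.
apply: (@bounded_continuous_le _ (`|u| * `|x|)) => t.
  by apply: cvgM; exact: bcfun_continuous.
by rewrite normrM ler_pM// supnorm_ub.
Qed.

Definition bcfun_mul (u x : bcfun T R) : bcfun T R :=
  BCFun (bcfun_mul_subproof u x).

Lemma bcfun_mul_is_linear (u : bcfun T R) : linear (bcfun_mul u).
Proof.
move=> a x y; apply/val_inj/funext => t /=.
by rewrite mulrDr; congr (_ + _); rewrite mulrCA.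
Qed.

HB.instance Definition _ (u : bcfun T R) :=
  GRing.isLinear.Build R (bcfun T R) (bcfun T R) _ (bcfun_mul u)
    (bcfun_mul_is_linear u).

Lemma bcfun_mul_continuous (u : bcfun T R) : continuous (bcfun_mul u).
Proof.
apply/linear_bounded_continuous/linear_boundedP.
exists `|u|; split=> [|r /ltW ur x]; first exact: num_real.
apply: supnorm_le => [|t /=].
  by rewrite mulr_ge0// (le_trans _ ur).
by rewrite normrM ler_pM ?supnorm_ub// (le_trans (supnorm_ub u t)).
Qed.

Lemma superposition_subproof (g : bcfun R R) (x : bcfun T R) :
  g \o x \in @bounded_continuous T R.
Proof.
apply: (@bounded_continuous_le _ `|g|) => t; last exact: supnorm_ub.
exact: continuous_comp (@bcfun_continuous _ _ x t) (@bcfun_continuous _ _ g _).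
Qed.

Definition superposition (g : bcfun R R) (x : bcfun T R) : bcfun T R :=
  BCFun (superposition_subproof g x).

Lemma differentiable_superposition (g dg : bcfun R R) (K : R) (x : bcfun T R) :
  (forall s h, `|g (s + h) - g s - dg s * h| <= K * h ^+ 2) ->
  differentiable (superposition g) x.
Proof.
move=> gK.
apply: (@differentiable_quadratic _ _ _ _ _
  (bcfun_mul (superposition dg x)) `|K|).
  exact: bcfun_mul_continuous.
move=> h; apply: supnorm_le => [|t /=]; first by rewrite mulr_ge0// exprn_ge0.
rewrite (le_trans (gK _ _))// -(real_normK (num_real (h t))).
rewrite (le_trans (ler_wpM2r _ (ler_norm K))) ?exprn_ge0//.
by rewrite ler_wpM2l// lerXn2r ?nnegrE// supnorm_ub.
Qed.

End Superposition.

(** * A truncation of the real line with Lipschitz derivative *)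

Section SoftTruncation.
Context {R : realType}.
Implicit Types s h a c : R.

Definition pos_part s : R := Num.max s 0.

(** The primitive, vanishing at [0], of the trapezoidal function that is [1] on
    [[-1, 1]], [0] outside of [[-2, 2]] and affine in between. Written with
    squared positive parts, it inherits its Taylor estimate from theirs. *)
Definition soft_trunc s : R :=
  s - (pos_part (s - 1) ^+ 2 - pos_part (s - 2) ^+ 2
       - pos_part (- s - 1) ^+ 2 + pos_part (- s - 2) ^+ 2) / 2.

Definition soft_trunc_deriv s : R :=
  1 - (pos_part (s - 1) - pos_part (s - 2)
       + pos_part (- s - 1) - pos_part (- s - 2)).

Lemma pos_part_sqr_taylor s h :
  `|pos_part (s + h) ^+ 2 - pos_part s ^+ 2 - 2 * pos_part s * h| <= h ^+ 2.
Proof.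
rewrite ler_norml /pos_part; apply/andP.
by case: (leP s 0) => s0; case: (leP (s + h) 0) => h0; split; nra.
Qed.

(** Four applications of [pos_part_sqr_taylor], each weighted by [1 / 2]. *)
Lemma soft_trunc_taylor s h :
  `|soft_trunc (s + h) - soft_trunc s - soft_trunc_deriv s * h| <= 2 * h ^+ 2.
Proof.
have P c := pos_part_sqr_taylor (s - c) h.
have N c := pos_part_sqr_taylor (- s - c) (- h).
have := P 1; have := P 2; have := N 1; have := N 2.
have E c : s - c + h = s + h - c by ring.
have F c : - s - c - h = - (s + h) - c by ring.
rewrite !E !F !ler_norml !sqrrN /soft_trunc /soft_trunc_deriv.
move=> /andP[? ?] /andP[? ?] /andP[? ?] /andP[? ?].
by apply/andP; split; lra.
Qed.

Lemma soft_trunc_id s : `|s| <= 1 -> soft_trunc s = s.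
Proof.
rewrite ler_norml => /andP[s0 s1].
by rewrite /soft_trunc /pos_part !max_r; lra.
Qed.

Lemma soft_trunc_le s : `|soft_trunc s| <= 2.
Proof.
rewrite ler_norml /soft_trunc /pos_part; apply/andP.
case: (leP (s - 1) 0) => ?; case: (leP (s - 2) 0) => ?;
  case: (leP (- s - 1) 0) => ?; case: (leP (- s - 2) 0) => ?; split; nra.
Qed.

Lemma soft_trunc_deriv_le s : `|soft_trunc_deriv s| <= 1.
Proof.
rewrite ler_norml /soft_trunc_deriv /pos_part; apply/andP.
case: (leP (s - 1) 0) => ?; case: (leP (s - 2) 0) => ?;
  case: (leP (- s - 1) 0) => ?; case: (leP (- s - 2) 0) => ?; split; lra.
Qed.

Lemma pos_part_continuous : continuous pos_part.
Proof. by move=> s; apply: continuous_max => //; exact: cvg_cst. Qed.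

Lemma pos_part_subr_continuous c : continuous (fun s => pos_part (s - c)).
Proof.
move=> s; apply: (@continuous_comp _ _ _ (fun s => s - c)).
  by apply: cvgB => //; exact: cvg_cst.
exact: pos_part_continuous.
Qed.

Lemma pos_part_oppB_continuous c : continuous (fun s => pos_part (- s - c)).
Proof.
move=> s; apply: (@continuous_comp _ _ _ (fun s => - s - c)).
  by apply: cvgB; [exact: cvgN|exact: cvg_cst].
exact: pos_part_continuous.
Qed.

Lemma soft_trunc_continuous : continuous soft_trunc.
Proof.
have pc := pos_part_subr_continuous; have nc := pos_part_oppB_continuous.
move=> s; apply: cvgB => //; apply: cvgM; last exact: cvg_cst.
apply: cvgD; last by apply: cvgM; exact: nc.
apply: cvgB; last by apply: cvgM; exact: nc.
by apply: cvgB; apply: cvgM; exact: pc.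
Qed.

Lemma soft_trunc_deriv_continuous : continuous soft_trunc_deriv.
Proof.
have pc := pos_part_subr_continuous; have nc := pos_part_oppB_continuous.
move=> s; apply: cvgB; first exact: cvg_cst.
apply: cvgB; last exact: nc.
apply: cvgD; last exact: nc.
by apply: cvgB; exact: pc.
Qed.

Lemma soft_trunc_scaled a : 0 < a -> exists g dg : bcfun R R,
  [/\ forall s, `|s| <= a -> g s = s,
      forall s, `|g s| <= 2 * a &
      forall s h, `|g (s + h) - g s - dg s * h| <= 2 / a * h ^+ 2].
Proof.
move=> a0.
have divc : continuous (fun s : R => s / a).
  by move=> s; apply: cvgM => //; exact: cvg_cst.
have gM s : `|a * soft_trunc (s / a)| <= 2 * a.
  by rewrite normrM gtr0_norm// mulrC ler_wpM2r ?(ltW a0)// soft_trunc_le.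
have gc : continuous (fun s => a * soft_trunc (s / a)).
  move=> s; apply: cvgM; first exact: cvg_cst.
  exact: continuous_comp (divc s) (@soft_trunc_continuous _).
have dgc : continuous (fun s => soft_trunc_deriv (s / a)).
  move=> s; exact: continuous_comp (divc s) (@soft_trunc_deriv_continuous _).
exists (BCFun (bounded_continuous_le gc gM)).
have dgM s : `|soft_trunc_deriv (s / a)| <= 1 by exact: soft_trunc_deriv_le.
exists (BCFun (bounded_continuous_le dgc dgM)).
split=> [s sa||s h] //=.
  have sa1 : `|s / a| <= 1.
    by rewrite normrM normfV (gtr0_norm a0) ler_pdivrMr// mul1r.
  by rewrite (soft_trunc_id sa1) mulrC divfK// gt_eqF.
have -> : a * soft_trunc ((s + h) / a) - a * soft_trunc (s / a) -
    soft_trunc_deriv (s / a) * h =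
    a * (soft_trunc (s / a + h / a) - soft_trunc (s / a) -
         soft_trunc_deriv (s / a) * (h / a)).
  by rewrite mulrDl; field; rewrite gt_eqF.
have -> : 2 / a * h ^+ 2 = a * (2 * (h / a) ^+ 2) by field; rewrite gt_eqF.
by rewrite normrM (gtr0_norm a0) ler_wpM2l ?(ltW a0)// soft_trunc_taylor.
Qed.

End SoftTruncation.

(** * Globalization of germs *)

Lemma bcfun_local_retraction (R : realType) (T : topologicalType)
    (W : set (bcfun T R)) : nbhs 0 W ->
  exists p : bcfun T R -> bcfun T R,
    [/\ forall x, differentiable p x, \forall x \near 0, p x = x &
        forall x, W (p x)].
Proof.
move=> /nbhs_norm0P[e /= e0 eW].
(* [soft_trunc_scaled] bounds the values by twice the radius of the interval on
   which [g] is the identity: [2 * (e / 3) < e]. *)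
have a0 : 0 < e / 3 by rewrite divr_gt0.
have [g [dg [gid gle gtaylor]]] := soft_trunc_scaled a0.
exists (superposition g); split=> [x||x].
- exact: (differentiable_superposition _ gtaylor).
- apply/nbhs_norm0P; exists (e / 3) => // x /= xa.
  apply/val_inj/funext => t /=; apply: gid.
  exact: le_trans (supnorm_ub x t) (ltW xa).
- apply: eW => /=; apply: (@le_lt_trans _ _ (2 * (e / 3))); last by lra.
  apply: supnorm_le => [|t]; last exact: gle.
  by rewrite mulr_ge0// ltW.
Qed.

(** The sense [diff] of differentiability enters only through its chain rule.
    The retraction maps into [W `&` dom f]: into [W] for the differentiability
    of [f \o p], into [dom f] for its domain to be the whole space. *)
Lemma global_representative_exists (R : realType) (X : normedModType R)
    (Y : topologicalLmodType R) (diff : set X -> (X -> Y) -> X -> Prop) :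
  (forall W : set X, nbhs 0 W -> exists p : X -> X,
    [/\ forall x, differentiable p x, \forall x \near 0, p x = x &
        forall x, W (p x)]) ->
  (forall D f (p : X -> X) x, differentiable p x -> diff D f (p x) ->
    diff (p @^-1` D) (f \o p) x) ->
  forall G : germ X Y, differentiable_germ diff G ->
    exists f, global_representative diff G f.
Proof.
move=> retr chain G [f Gf [W W0 fW]].
have [p [pdiff pid pWD]] := retr _ (filterI W0 (dom_nbhs f)).
exists (LocalMap filterT (f \o p)); split=> //=; last first.
  move=> x _; have [Wpx _] := pWD x.
  have := chain _ _ _ _ (pdiff x) (fW _ Wpx).
  suff -> : p @^-1` dom f = setT by [].
  by apply/seteqP; split=> // y _; have [] := pWD y.
have [f0 Gf0] := germ_class G; move: Gf; rewrite Gf0 /=.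
move=> /same_germ_trans; apply.
exists (dom f `&` [set x | p x = x]); first exact: filterI (dom_nbhs f) pid.
by split=> [x [? _]|x [_ /= ->]].
Qed.

Theorem corollary4p5 (R : realType) (T : topologicalType)
    (Y : topologicalLmodType R) :
  (forall G : germ (bcfun T R) Y,
     differentiable_germ bounded_differentiable_at G ->
     exists f, global_representative bounded_differentiable_at G f) /\
  (forall G : germ (bcfun T R) Y,
     differentiable_germ compact_differentiable_at G ->
     exists f, global_representative compact_differentiable_at G f).
Proof.
split; apply: global_representative_exists.
- exact: bcfun_local_retraction.
- exact: bounded_differentiable_comp.
- exact: bcfun_local_retraction.
- exact: compact_differentiable_comp.
Qed.
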